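(* Let $N\ge 2$ be an integer. Then $$c_n^{(N)} = N^n \times c_n,\qquad n=0,1,2,\dots,$$ where $c_n=\frac{1}{n+1}\binom{2n}{n}$ is the usual Catalan number, $c_0^{(N)}=1$, and for $n\ge 1$, $c_n^{(N)}=|B_n^N|$ is the number of words of length $2n$ in the symbols $S_1^*,\dots,S_N^*,S_1,\dots,S_N$ whose product in the Cuntz algebra $\mathcal{O}_N$ equals $1$. (The numbers $N^n\times c_n$ are called the $N$-colored Catalan numbers.)
   Context: The Cuntz algebra $\mathcal{O}_N$ ($N\ge2$) is the $C^*$-algebra generated by bounded linear operators $S_1,\dots,S_N$ on a Hilbert space satisfying $\sum_{j=1}^N S_jS_j^*=1$ and $S_i^*S_i=1$ for $i=1,\dots,N$ (its algebraic structure does not depend on the choice of such a family). Let $\Sigma_N=\{S_1^*,\dots,S_N^*,S_1,\dots,S_N\}$, regarded as a set of $2N$ symbols, and let $W_{2n}^N$ be the set of all words $X=(X_1,\dots,X_{2n})$ with $X_i\in\Sigma_N$. Put $\pi_N(X)=X_1\cdots X_{2n}\in\mathcal{O}_N$ (the product of the corresponding operators) and $B_n^N=\{X\in W_{2n}^N \mid \pi_N(X)=1\}$. *)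

(* Defs.v *)
From HB Require Import structures.
From mathcomp Require Import all_boot all_order all_algebra.
From mathcomp Require Import complex.
From mathcomp Require Import all_classical all_reals topology normedtype.

Set Implicit Arguments.
Unset Strict Implicit.
Unset Printing Implicit Defensive.

Import Order.TTheory GRing.Theory Num.Theory.
Import numFieldNormedType.Exports.

Local Open Scope classical_set_scope.
Local Open Scope ring_scope.

(** Complex Hilbert spaces are presented as complete normed modules over [R[i]]
    together with an inner product inducing the norm.  The form is linear on
    the left and conjugate-linear on the right. *)
Definition inner_product_norm (R : realType) (H : completeNormedModType R[i])
    (ip : {dot H for @Num.conj R[i]}) : Prop :=
  forall x : H, `|x| ^+ 2 = ip x x.

Section Operators.
Variables (R : realType) (H : completeNormedModType R[i]).
Variable ip : {dot H for @Num.conj R[i]}.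
Implicit Types (T : H -> H) (A : set (H -> H)).

Definition bounded_operator T : Prop :=
  linear T /\ exists M : R[i], forall x : H, `|T x| <= M * `|x|.

(** On a Hilbert space a bounded operator has exactly one adjoint. *)
Definition is_adjoint T Tstar : Prop :=
  forall x y : H, ip (T x) y = ip x (Tstar y).

(** C*-subalgebras of B(H); [cstar_closed] is closedness for the operator
    norm. *)
Record cstar_subalgebra A : Prop := CstarSubalgebra {
  cstar_bounded : forall T, A T -> bounded_operator T;
  cstar_zero : A (fun=> 0);
  cstar_add : forall T T', A T -> A T' -> A (fun x => T x + T' x);
  cstar_scale : forall (a : R[i]) T, A T -> A (fun x => a *: T x);
  cstar_mul : forall T T', A T -> A T' -> A (T \o T');
  cstar_star : forall T Tstar, A T -> is_adjoint T Tstar -> A Tstar;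
  cstar_closed : forall T, bounded_operator T ->
    (forall e : R[i], 0 < e ->
       exists2 T', A T' & forall x, `|T x - T' x| <= e * `|x|) -> A T
}.

Variable N : nat.
Variables S Sstar : 'I_N -> H -> H.

Record cuntz_family : Prop := CuntzFamily {
  cuntz_bounded : forall i, bounded_operator (S i);
  cuntz_adjoint : forall i, is_adjoint (S i) (Sstar i);
  cuntz_sum : (fun x => \sum_(j < N) S j (Sstar j x)) = idfun;
  cuntz_isometry : forall i, Sstar i \o S i = idfun
}.

Definition cuntz_algebra : set (H -> H) :=
  smallest cstar_subalgebra (range S).

(** The 2N formal symbols: [inl i] stands for S_i^* and [inr i] for S_i. *)
Definition cuntz_symbol : finType := ('I_N + 'I_N)%type.

Definition cuntz_symbol_op (a : cuntz_symbol) : H -> H :=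
  match a with inl i => Sstar i | inr i => S i end.

(** pi_N(X_1, ..., X_m) = X_1 ... X_m, where the product of operators is
    composition (so X_m acts first) and the empty product is 1. *)
Definition cuntz_word_op (X : seq cuntz_symbol) : H -> H :=
  foldr (fun a T => cuntz_symbol_op a \o T) idfun X.

(** The products pi_N(X) do lie in O_N, whose unit is the identity of H and
    where equality is equality of operators. *)
Lemma cuntz_word_op_in (X : seq cuntz_symbol) :
  (0 < N)%N -> cuntz_family -> cuntz_algebra (cuntz_word_op X).
Proof.
move=> N0 [_ adjS _ isoS] A [cA SA].
have AS i : A (S i) by apply: SA; exists i.
have ASs i : A (Sstar i) by apply: (cstar_star cA (AS i)); exact: adjS.
elim: X => [|[i|i] X IH] /=.
- by rewrite -(isoS (Ordinal N0)); apply: (cstar_mul cA).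
- exact: (cstar_mul cA).
- exact: (cstar_mul cA).
Qed.

(** B_n^N, the words of length 2n whose product in O_N is 1. *)
Definition cuntz_words (n : nat) : {set n.*2.-tuple cuntz_symbol} :=
  finset (fun X : n.*2.-tuple cuntz_symbol => `[< cuntz_word_op X = idfun >]).

Definition cuntz_catalan (n : nat) : nat :=
  if n is 0 then 1%N else #|cuntz_words n|.

End Operators.

Definition catalan (n : nat) : nat := ('C(n.*2, n) %/ n.+1)%N.

(** The division in [catalan] is exact. *)
Lemma catalanE (n : nat) : (n.+1 * catalan n = 'C(n.*2, n))%N.
Proof.
have dv : (n.+1 %| 'C(n.*2, n))%N.
  rewrite -(@Gauss_dvdr _ n) ?coprimeSn //.
  have := mul_bin_left n.*2 n.
  rewrite -addnn addnK => <-; exact: dvdn_mulr.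
by rewrite /catalan mulnC divnK.
Qed.

(* Main.v *)
(** A word equals 1 iff it is a coloured Dyck word: since [S_i^* S_j] is 1 or 0
    according as [i = j] or not, a scan from the left keeps a stack of the
    colours of the [S_i^*] not yet cancelled by a matching [S_i]. Any mismatch
    makes the product 0, a leading [S_j] gives it proper range, and a leftover
    [S_i^*] gives it a kernel, so exactly the words that empty the stack are
    equal to 1. By the ballot recurrence, the words of length [2u + k] that
    empty a stack of height [k] number
    [N^u ('C(2u + k, u) - 'C(2u + k, u - 1))]. *)

Require Import Defs.
From mathcomp Require Import all_boot all_order all_algebra.
From mathcomp Require Import complex.
From mathcomp Require Import all_classical all_reals topology normedtype.
From mathcomp Require Import zify.

Set Implicit Arguments.
Unset Strict Implicit.
Unset Printing Implicit Defensive.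

Import Order.TTheory GRing.Theory Num.Theory.

Lemma card_tupleS (T : finType) (P : pred (seq T)) (m : nat) :
  #|[set X : m.+1.-tuple T | P X]|
  = \sum_(a : T) #|[set X : m.-tuple T | P (a :: X)]|.
Proof.
rewrite -sum1_card; under [RHS]eq_bigr do rewrite -sum1_card.
rewrite pair_big_dep /=.
rewrite (reindex (fun p : T * m.-tuple T => [tuple of p.1 :: p.2])) /=.
  by apply: eq_bigl => -[a X]; rewrite !inE.
exists (fun X : m.+1.-tuple T => (thead X, [tuple of behead X]))
  => [[a X] _|X _].
  by congr pair; apply: val_inj.
by rewrite /= -tuple_eta.
Qed.

Section ColouredDyck.
Variable N : nat.
Implicit Types (s : seq 'I_N) (w : seq (cuntz_symbol N)).

Fixpoint empties_stack s w : bool :=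
  match w, s with
  | [::], _ => nilp s
  | inl i :: w', _ => empties_stack (i :: s) w'
  | inr j :: w', i :: s' => (i == j) && empties_stack s' w'
  | inr _ :: _, [::] => false
  end.

Definition num_emptying m s : nat :=
  #|[set X : m.-tuple (cuntz_symbol N) | empties_stack s X]|.

Lemma num_emptying0 s : num_emptying 0 s = nilp s.
Proof.
rewrite /num_emptying -sum1_card; case: (boolP (nilp s)) => sP.
  rewrite (eq_bigl predT) => [|X]; last by rewrite inE tuple0 /= sP.
  by rewrite sum1_card card_tuple.
by rewrite big_pred0 // => X; rewrite inE tuple0 /= (negbTE sP).
Qed.

Lemma num_emptyingS m s :
  num_emptying m.+1 s =
  \sum_i num_emptying m (i :: s)
  + (if s is _ :: s' then num_emptying m s' else 0).
Proof.
rewrite /num_emptying card_tupleS big_sumType /=; congr addn.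
case: s => [|i s].
  by rewrite big1 // => j _; apply: eq_card0 => X; rewrite !inE.
rewrite (bigD1 i) //= big1 ?addn0 => [|j ji].
  by apply: eq_card => X; rewrite !inE eqxx.
by apply: eq_card0 => X; rewrite !inE eq_sym (negbTE ji).
Qed.

(** Each symbol pops at most one colour. *)
Lemma num_emptying_small m s : m < size s -> num_emptying m s = 0.
Proof.
elim: m s => [|m IH] s ms; first by rewrite num_emptying0; case: s ms.
rewrite num_emptyingS big1 => [|i _]; last by rewrite IH //= ltnS ltnW // ltnW.
by case: s ms => //= i s ms; rewrite IH.
Qed.

(** Here [u] is the number of pushes. The ballot difference is written as a sum to avoid truncated
    subtraction, with ['C(m, -1)] read as 0. A first push lowers [u] by one and has [N] colours to
    choose from; a first pop keeps [u]; Pascal's rule joins the two. *)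
Lemma num_emptying_ballot m u s :
  m = u.*2 + size s ->
  num_emptying m s + N ^ u * (if u is v.+1 then 'C(m, v) else 0)
  = N ^ u * 'C(m, u).
Proof.
elim: m u s => [|m IH] u s Em.
  have /nilP -> : nilp s by rewrite /nilp; lia.
  have -> : u = 0 by lia.
  by rewrite num_emptying0 bin0.
rewrite num_emptyingS; case: u Em => [|u] Em.
  rewrite big1 => [|i _]; last by apply: num_emptying_small => /=; lia.
  case: s Em => [|j s] /= Em; first by lia.
  by have := IH 0 s; rewrite !bin0 => <-; lia.
have push i : num_emptying m (i :: s)
    = N ^ u * 'C(m, u) - N ^ u * (if u is v.+1 then 'C(m, v) else 0).
  by rewrite -(IH u (i :: s)) ?addnK //=; lia.
(* Binomials increase up to the middle, so the subtraction in [push] is exact. *)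
have le_push : 'C(m, u) >= (if u is v.+1 then 'C(m, v) else 0).
  case: u Em {IH push} => // v Em.
  have := mul_bin_left m v; nia.
rewrite (eq_bigr _ (fun i _ => push i)) sum_nat_const card_ord -mulnBr.
set p := (if u is v.+1 then _ else _) in le_push *.
have binSu : 'C(m.+1, u) = 'C(m, u) + p.
  by rewrite /p; case: (u) => [|v]; rewrite ?bin0 // binS.
rewrite binSu binS mulnA -expnS.
case: s Em {push} => [|j s] /= Em.
  (* On an empty stack nothing can be popped; here [m] is [2u + 1], and symmetry of the binomials
     closes the recurrence. *)
  have -> : 'C(m, u.+1) = 'C(m, u).
    by rewrite -bin_sub; [congr 'C(_, _) | ]; lia.
  by rewrite addn0 -mulnDr; congr muln; lia.
have pop : num_emptying m s + N ^ u.+1 * 'C(m, u) = N ^ u.+1 * 'C(m, u.+1).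
  by apply: (IH u.+1); lia.
have le_pushM := leq_mul (leqnn (N ^ u.+1)) le_push.
by rewrite mulnBr !mulnDr -pop; lia.
Qed.

Lemma num_emptying_catalan n : num_emptying n.*2 [::] = N ^ n * catalan n.
Proof.
have := @num_emptying_ballot n.*2 n [::]; rewrite addn0 => /(_ erefl).
case: n => [|n]; first by rewrite muln0 addn0 => ->.
have Ecat := catalanE n.+1.
have := mul_bin_left n.+1.*2 n.
have -> : n.+1.*2 - n = n.+2 by lia.
move=> Eb E; have Ec : 'C(n.+1.*2, n.+1) = 'C(n.+1.*2, n) + catalan n.+1 by nia.
by rewrite Ec mulnDr in E; lia.
Qed.

End ColouredDyck.

Local Open Scope ring_scope.

Section CuntzWords.
Variables (R : realType) (N : nat) (H : completeNormedModType R[i]).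
Variable ip : {dot H for @Num.conj R[i]}.
Variables S Sstar : 'I_N -> H -> H.
Hypotheses (hN : (2 <= N)%N) (hip : inner_product_norm ip).
Hypotheses (hH : exists x : H, x <> 0) (hS : cuntz_family ip S Sstar).

Let ip_ge0 x : 0 <= ip x x. Proof. by rewrite -hip exprn_ge0. Qed.

Let ip_eq0 x : ip x x = 0 -> x = 0.
Proof. by move/eqP; rewrite -hip sqrf_eq0 normr_eq0 => /eqP. Qed.

Let SK i x : Sstar i (S i x) = x.
Proof. by have /(congr1 (@^~ x)) := cuntz_isometry hS i. Qed.

Let S0 i : S i 0 = 0.
Proof.
have [linS _] := cuntz_bounded hS i.
by have := linS (- 1) 0 0; rewrite scaler0 addr0 scaleN1r addNr.
Qed.

Let Sstar0 i : Sstar i 0 = 0.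
Proof. by rewrite -{1}(S0 i) SK. Qed.

(* Pairing [\sum_(j != k) S_j S_j^* S_k x = 0] with [S_k x] gives
   [\sum_(j != k) |S_j^* S_k x|^2 = 0]. *)
Lemma cuntz_orthogonal i k x : i != k -> Sstar i (S k x) = 0.
Proof.
move=> ik; apply: ip_eq0.
have := congr1 (@^~ (S k x)) (cuntz_sum hS); rewrite /= (bigD1 k) //= SK.
move/eqP; rewrite -subr_eq0 addrAC subrr add0r => /eqP Ez.
have := congr1 (fun y => ip y (S k x)) Ez.
rewrite linear0l linear_sumlz /=.
under eq_bigr do rewrite (cuntz_adjoint hS).
move/eqP; rewrite psumr_eq0 // => /allP/(_ i (mem_index_enum _)).
by rewrite ik => /eqP.
Qed.

Lemma cuntz_word_op_cat (u w : seq (cuntz_symbol N)) x :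
  cuntz_word_op S Sstar (u ++ w) x
  = cuntz_word_op S Sstar u (cuntz_word_op S Sstar w x).
Proof. by elim: u => //= a u ->. Qed.

Lemma cuntz_word_op0 (w : seq (cuntz_symbol N)) : cuntz_word_op S Sstar w 0 = 0.
Proof. by elim: w => //= -[i|i] w -> /=. Qed.

(** A second colour [k] gives vectors [S k x] that are killed by [Sstar i] and lie outside the range
    of [S i] when [x] is nonzero. *)
Lemma exists_other_colour (i : 'I_N) : exists k : 'I_N, k != i.
Proof.
have N0 : (0 < N)%N by exact: ltnW.
have [i0|i0] := eqVneq (i : nat) 0%N.
  by exists (Ordinal hN); rewrite -val_eqE /= i0.
by exists (Ordinal N0); rewrite -val_eqE /= eq_sym.
Qed.

(** The stack [s] stands for the scanned prefix after cancellation; [catrev] puts its top next to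
    [w], so that a push merely moves the boundary and holds by conversion. *)
Lemma cuntz_word_op_id_emptying s (w : seq (cuntz_symbol N)) :
  cuntz_word_op S Sstar (catrev [seq inl i | i <- s] w) = idfun
  <-> empties_stack s w.
Proof.
have [x0 x0P] := hH.
elim: w s => [|[i|j] w IH] s.
- case: s => [|i s]; first by split.
  (* The leftover [Sstar i] acts first and kills [S k x0], which is nonzero. *)
  split=> // E; have [k ki] := exists_other_colour i.
  have := congr1 (@^~ (S k x0)) E.
  rewrite /= catrevE cuntz_word_op_cat /= cuntz_orthogonal 1?eq_sym //.
  rewrite cuntz_word_op0 => /esym Sk0.
  by case: x0P; rewrite -(SK k x0) Sk0.
- exact: (IH (i :: s)).
- case: s => [|i s] /=.
  (* Applying [Sstar k] on the left kills the leading [S j], whereas the identity would return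
     [x0]. *)
  + split=> // E; have [k kj] := exists_other_colour j.
    have := congr1 (fun T => Sstar k (T (S k x0))) E.
    by rewrite /= cuntz_orthogonal // SK => /esym.
  + have [<-|ij] /= := eqVneq i j.
      rewrite -IH; suff -> : cuntz_word_op S Sstar
        (catrev [seq inl i | i <- s] [:: inl i, inr i & w])
        = cuntz_word_op S Sstar (catrev [seq inl i | i <- s] w) by [].
      by apply/funext => x; rewrite !catrevE !cuntz_word_op_cat /= SK.
    (* A mismatched pair makes the whole product 0, which would force [x0 = 0]. *)
    split=> // /(congr1 (@^~ x0)).
    rewrite /= catrevE cuntz_word_op_cat /= cuntz_orthogonal //.
    by rewrite cuntz_word_op0 => /esym.
Qed.

Lemma card_cuntz_words n :
  #|cuntz_words S Sstar n| = num_emptying n.*2 ([::] : seq 'I_N).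
Proof.
apply: eq_card => X; rewrite !inE.
by apply/asboolP/idP => /(cuntz_word_op_id_emptying [::] X).
Qed.

End CuntzWords.

Theorem proposition2p2 (R : realType) (N : nat) (hN : (2 <= N)%N)
    (H : completeNormedModType R[i]) (ip : {dot H for @Num.conj R[i]})
    (hip : inner_product_norm ip) (hH : exists x : H, x <> 0)
    (S Sstar : 'I_N -> H -> H) (hS : cuntz_family ip S Sstar) (n : nat) :
  cuntz_catalan S Sstar n = (N ^ n * catalan n)%N.
Proof.
case: n => [|n] //=.
by rewrite (card_cuntz_words hN hip hH hS) num_emptying_catalan.
Qed.
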